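(* The reduced interface matrix $G=\widetilde B_C\widetilde A^{-1}\widetilde B_C^{T}-\widetilde C$, acting on vectors $(\xi_\Gamma,p_\Gamma,\lambda_\Delta)\in\widehat W_\Gamma\oplus\widehat Q_\Gamma\oplus\Lambda$ and defined in the context, is symmetric and positive definite.
   Context: Domain. $\Omega\subset\mathbb R^d$ ($d=2$ or $3$) is a polygonal/polyhedral domain decomposed into $N$ nonoverlapping subdomains $\Omega_i$ of diameter $H_i$ forming a coarse finite element partition of $\bar\Omega$; $H=\max_i H_i$; $\Gamma=(\bigcup_i\partial\Omega_i)\setminus\partial\Omega$ is the interface. The boundary is partitioned as $\partial\Omega=\boldsymbol\Gamma_d\cup\boldsymbol\Gamma_t=\boldsymbol\Gamma_p\cup\boldsymbol\Gamma_f$ with $|\boldsymbol\Gamma_d|>0$, $|\boldsymbol\Gamma_p|>0$. Parameters. $\lambda,\mu,\kappa$ are positive and constant on each subdomain, with values $\lambda_i,\mu_i,\kappa_i$ on $\Omega_i$; $\alpha>0$ is a constant. Finite elements. $\mathcal T_h$ is a conforming, quasi-uniform, regular triangulation of $\Omega$ with mesh size $h$; each subdomain is a union of elements and nodes are aligned across $\Gamma$. $\mathbf V\subset (H^1_{\boldsymbol\Gamma_d}(\Omega))^d$, $W\subset L^2(\Omega)$, $Q\subset H^1_{\boldsymbol\Gamma_p}(\Omega)$ are finite element spaces (functions in $\mathbf V$ and $Q$ vanish on $\boldsymbol\Gamma_d$ and $\boldsymbol\Gamma_p$, respectively), and $(\mathbf V,W)$ is Stokes-stable: $\inf_{\eta\in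 W}\sup_{\mathbf v\in\mathbf V}\frac{(\mathrm{div}\,\mathbf v,\eta)}{\|\mathbf v\|_{\mathbf V}\|\eta\|_W}\ge\beta_S>0$. The bilinear forms, evaluated subdomain by subdomain, are $a(\mathbf u,\mathbf v)=\sum_i 2\mu_i\int_{\Omega_i}\epsilon(\mathbf u):\epsilon(\mathbf v)\,dx$ ($\epsilon$ = symmetric gradient), $b(\mathbf v,\xi)=-\sum_i\int_{\Omega_i}(\mathrm{div}\,\mathbf v)\xi\,dx$, $c(\xi,\eta)=\sum_i\frac1{\lambda_i}\int_{\Omega_i}\xi\eta\,dx$, $d(p,\eta)=\sum_i\frac{\alpha}{\lambda_i}\int_{\Omega_i}p\,\eta\,dx$, $e(p,q)=\sum_i\int_{\Omega_i}(\kappa_i\nabla p\cdot\nabla q+\frac{2\alpha^2}{\lambda_i}pq)\,dx$. Put $$\mathcal K\big((\mathbf u,\xi,p),(\mathbf v,\eta,q)\big)=a(\mathbf u,\mathbf v)+b(\mathbf v,\xi)+b(\mathbf u,\eta)-c(\xi,\eta)+d(p,\eta)+d(q,\xi)-e(p,q).$$ Space splitting. $\mathbf V=\mathbf V_I\oplus\widehat{\mathbf V}_\Gamma$, $W=W_I\oplus\widehat W_\Gamma$, $Q=Q_I\oplus\widehat Q_\Gamma$, where the subscript $I$ denotes direct sums over $i$ of subdomain-interior degrees of freedom and $\widehat{\ }_\Gamma$ denotes the interface degrees of freedom, which are shared by neighbouring subdomains. The partially assembled displacement interface space is $\widetilde{\mathbf V}_\Gamma=\mathbf V_\Delta\oplus\widehat{\mathbf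 V}_\Pi$, $\mathbf V_\Delta=\bigoplus_i\mathbf V_\Delta^{(i)}$. Here $\widehat{\mathbf V}_\Pi$ (also written $\mathbf V_\Pi$) is the space of globally continuous primal displacement variables: for $d=2$ it is spanned by the subdomain vertex displacement variables; for $d=3$ by the subdomain vertex displacement nodal basis functions and additional edge and/or face average basis functions; it is assumed sufficiently large to control the rigid body motions of the subdomains. $\mathbf V_\Delta^{(i)}$ consists of the interface displacement functions of $\Omega_i$ vanishing at the primal degrees of freedom; functions in $\mathbf V_\Delta$ need not be continuous across $\Gamma$. $B_\Delta=[B_\Delta^{(1)}\ \cdots\ B_\Delta^{(N)}]$ is the matrix with entries in $\{-1,0,1\}$, each row having exactly two nonzero entries $1$ and $-1$, such that $B_\Delta\mathbf v_\Delta=0$ expresses the continuity of the dual displacement degrees of freedom across $\Gamma$. $\Lambda$ is the range of $B_\Delta$ on $\mathbf V_\Delta$. Matrices. $\widetilde A$ is the symmetric (invertible) matrix of $\mathcal K$ restricted to $\mathbf V_I\oplus W_I\oplus Q_I\oplus\mathbf V_\Delta\oplus\mathbf V_\Pi$. $\widetilde B_C$ maps $v=(\mathbf u_I,\xi_I,p_I,\mathbf u_\Delta,\mathbf u_\Pi)$ to a vector with three components: the first two are the vectors obtained by evaluating $\mathcal K(v,\cdot)$ on the test functions of $\widehat W_\Gamma$ and $\widehat Q_\Gamma$, respectively; the third is $B_\Delta\mathbf u_\Delta$. $\widetilde C$ is the matrix of $\mathcal K$ restricted to $\widehat W_\Gamma\oplus\widehat Q_\Gamma$, extended by zero on $\Lambda$,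 that is $\widetilde C=\begin{bmatrix}-C_{\Gamma\Gamma}&D_{\Gamma\Gamma}^T&0\\ D_{\Gamma\Gamma}&-E_{\Gamma\Gamma}&0\\0&0&0\end{bmatrix}$, where $C,D,E$ are the matrices of $c,d,e$. *)

(* Defs.v *)
From HB Require Import structures.
From mathcomp Require Import all_boot all_order all_algebra.
From mathcomp Require Import all_classical all_reals all_analysis.
From mathcomp Require mpoly.
Import Order.TTheory GRing.Theory Num.Theory.
Import numFieldNormedType.Exports.

Set Implicit Arguments.
Unset Strict Implicit.
Unset Printing Implicit Defensive.

Local Open Scope classical_set_scope.
Local Open Scope ring_scope.

Section product_cons.
Local Open Scope ereal_scope.
Context d (T : measurableType d) (R : realType) (n : nat).
Variable m1 : {sigma_finite_measure set T -> \bar R}.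
Variable m : {sigma_finite_measure set (n.-tuple T) -> \bar R}.

Definition tcons (z : T * n.-tuple T) : n.+1.-tuple T := [tuple of z.1 :: z.2].
Let tuncons (x : n.+1.-tuple T) : T * n.-tuple T :=
  (thead x, [tuple of behead x]).

Let tconsK : cancel tcons tuncons.
Proof. by case=> a t; rewrite /tuncons theadE; congr pair; exact: val_inj. Qed.

Let measurable_tcons A : measurable A -> measurable (tcons @^-1` A).
Proof.
have mt : measurable_fun setT tcons by exact: measurable_cons.
by move=> mA; rewrite -[X in measurable X]setTI; exact: mt.
Qed.

(* The image of the product measure [m1 \x m] under [(a, t) |-> a :: t]. *)
Definition product_cons : set (n.+1.-tuple T) -> \bar R :=
  fun A => (m1 \x m) (tcons @^-1` A).

Let product_cons0 : product_cons set0 = 0.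
Proof. by rewrite /product_cons preimage_set0 measure0. Qed.

Let product_cons_ge0 A : 0 <= product_cons A.
Proof. exact: measure_ge0. Qed.

Let product_cons_sigma_additive : semi_sigma_additive product_cons.
Proof.
move=> F mF tF mUF; rewrite /product_cons preimage_bigcup.
apply: measure_semi_sigma_additive.
- by move=> k; exact: measurable_tcons.
- apply/trivIsetP => /= i j _ _ ij; rewrite -preimage_setI.
  by move/trivIsetP : tF => /(_ _ _ _ _ ij) ->//; rewrite preimage_set0.
- by rewrite -preimage_bigcup; exact: measurable_tcons.
Qed.

HB.instance Definition _ := isMeasure.Build _ _ _ product_cons
  product_cons0 product_cons_ge0 product_cons_sigma_additive.

Let product_cons_sigma_finite : sigma_finite setT product_cons.
Proof.
have /sigma_finiteP[F [TF ndF Foo]] := sigma_finiteT m1.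
have /sigma_finiteP[G [TG ndG Goo]] := sigma_finiteT m.
exists (fun k => tuncons @^-1` (F k `*` G k)).
  rewrite -preimage_bigcup (_ : \bigcup_k (F k `*` G k) = setT) ?preimage_setT//.
  apply/seteqP; split => // -[x y] _.
  have [k _ Fx] : (\bigcup_k F k) x by rewrite -TF.
  have [l _ Gy] : (\bigcup_k G k) y by rewrite -TG.
  exists (maxn k l) => //; split.
    by move: x Fx; exact/subsetPset/ndF/leq_maxl.
  by move: y Gy; exact/subsetPset/ndG/leq_maxr.
move=> k; have [mF Foo'] := Foo k; have [mG Goo'] := Goo k; split.
  rewrite -[X in measurable X]setTI.
  have mt : measurable_fun setT tuncons.
    apply/measurable_fun_pairP; split; last exact: measurable_behead.
    exact: measurable_tnth.
  by apply: mt => //; exact: measurableX.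
rewrite /product_cons (_ : _ @^-1` _ = F k `*` G k); last first.
  rewrite -comp_preimage (_ : tuncons \o tcons = id)//.
  by apply/funext => z; exact: tconsK.
by rewrite product_measure1E// lte_mul_pinfty// ge0_fin_numE.
Qed.

HB.instance Definition _ := Measure_isSigmaFinite.Build _ _ _ product_cons
  product_cons_sigma_finite.

End product_cons.

(* n-dimensional Lebesgue measure, on the n.-tuples of reals. *)
Fixpoint lebesgue_rn (R : realType) (n : nat) :
    {sigma_finite_measure set (n.-tuple (measurableTypeR R)) -> \bar R} :=
  match n with
  | 0 => \d_([tuple] : 0.-tuple (measurableTypeR R))
  | n'.+1 => product_cons lebesgue_measure (lebesgue_rn R n')
  end.

Section geometry.
Variables (R : realType) (d : nat).
Implicit Types (A F P : set 'rV[R]_d) (V : 'M[R]_(d.+1, d)).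

Definition pt (n : nat) (t : n.-tuple (measurableTypeR R)) : 'rV[R]_n :=
  \row_i tnth t i.

(* Lebesgue integral over a subset of R^n, with R^n identified with 'rV_n. *)
Definition integral_rn (n : nat) (A : set 'rV[R]_n) (f : 'rV[R]_n -> R) : R :=
  (\int[lebesgue_rn R n]_(t in [set t | A (pt t)]) f (pt t))%R.

(* The norm of the library on 'rV_n is the max norm. *)
Definition enorm (x : 'rV[R]_d) : R := Num.sqrt (\sum_k x 0 k ^+ 2).

Definition diam A : R :=
  sup [set r | exists x y, [/\ A x, A y & r = enorm (x - y)]].

Definition inradius A : R :=
  sup [set r | 0 <= r /\ exists x, forall y, enorm (y - x) <= r -> A y].

(* Simplices are given by the matrix whose rows are the d+1 vertices, and their
   points by barycentric coordinates. *)
Definition nondegenerate V : Prop := (row_mx (const_mx 1) V : 'M[R]_(1 + d)) \in unitmx.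

Definition subsimplex V (S : pred 'I_d.+1) : set 'rV[R]_d :=
  [set x | exists c : 'rV[R]_d.+1,
    [/\ forall k, 0 <= c 0 k, forall k, ~~ S k -> c 0 k = 0,
        \sum_k c 0 k = 1 & x = c *m V]].

Definition simplex V := subsimplex V xpredT.

Definition open_simplex V : set 'rV[R]_d :=
  [set x | exists c : 'rV[R]_d.+1,
    [/\ forall k, 0 < c 0 k, \sum_k c 0 k = 1 & x = c *m V]].

(* The facet opposite to vertex k. *)
Definition facet V (k : 'I_d.+1) := subsimplex V (fun j => j != k).

(* (d-1)-dimensional measure of [facet V k]: replacing the row k of [1 | V] by
   (1, x) makes the determinant an affine function of x vanishing on the facet;
   its gradient, whose components are cofactors, has norm (d-1)! times the
   measure of the facet. *)
Definition facet_measure V (k : 'I_d.+1) : R :=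
  Num.sqrt (\sum_(l < d)
    cofactor (row_mx (const_mx 1) V : 'M[R]_(1 + d)) k (lift ord0 l) ^+ 2) / (d.-1)`!%:R.

(* Faces in the sense of convex geometry. *)
Definition is_face F P : Prop :=
  [/\ F `<=` P, convex_set (F : set (convex_lmodType 'rV[R]_d)) &
      forall (x y : 'rV[R]_d) (t : R), P x -> P y -> 0 < t < 1 ->
        F (t *: x + (1 - t) *: y) -> F x /\ F y].

Definition polynomial_on A (f : 'rV[R]_d -> R) : Prop :=
  exists p : mpoly.mpoly d R,
    forall x, A x -> f x = mpoly.meval (fun k => x 0 k) p.

Definition pderiv (k : 'I_d) (f : 'rV[R]_d -> R) (x : 'rV[R]_d) : R :=
  'D_(delta_mx 0 k : 'rV[R]_d) f x.

Definition strain (v : 'rV[R]_d -> 'rV[R]_d) (x : 'rV[R]_d) (k l : 'I_d) : R :=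
  (pderiv k (fun y => v y 0 l) x + pderiv l (fun y => v y 0 k) x) / 2.

Definition divergence (v : 'rV[R]_d -> 'rV[R]_d) (x : 'rV[R]_d) : R :=
  \sum_k pderiv k (fun y => v y 0 k) x.

End geometry.

(* A simplicial mesh of dimension d whose elements are distributed among N
   subdomains. *)
Record mesh (R : realType) (d N : nat) := Mesh {
  elt : finType;
  vtx : elt -> 'M[R]_(d.+1, d);
  dom : elt -> 'I_N
}.

Record coefficients (R : realType) (N : nat) := Coefficients {
  lam : 'I_N -> R;
  mu : 'I_N -> R;
  kap : 'I_N -> R;
  alpha : R
}.

Definition positive_coefficients (R : realType) (N : nat)
    (co : coefficients R N) : Prop :=
  (forall i, [/\ 0 < lam co i, 0 < mu co i & 0 < kap co i]) /\ 0 < alpha co.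

(* [VertexDof x k] is the k-th component of the displacement at x, and
   [AverageDof F A b k] the average of the k-th component over F, which lies in
   the affine subspace of dimension m parametrized by t |-> b + t *m A. *)
Inductive primal_dof (R : realType) (d : nat) :=
| VertexDof of 'rV[R]_d & 'I_d
| AverageDof (F : set 'rV[R]_d) (m : nat) (A : 'M[R]_(m, d)) (b : 'rV[R]_d)
    (k : 'I_d).

(* Bases of V, W and Q. The basis of V is the one obtained after the change of
   variables that makes the primal degrees of freedom explicit; [primal] selects
   the basis functions spanning the primal space. [pdof] is only meaningful on
   [primal]. *)
Record fe_data (R : realType) (d : nat) := FEData {
  dimV : nat;
  dimW : nat;
  dimQ : nat;
  psi : 'I_dimV -> 'rV[R]_d -> 'rV[R]_d;
  chi : 'I_dimW -> 'rV[R]_d -> R;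
  phi : 'I_dimQ -> 'rV[R]_d -> R;
  primal : pred 'I_dimV;
  pdof : 'I_dimV -> primal_dof R d
}.

Arguments psi {R d} f _ _.
Arguments chi {R d} f _ _.
Arguments phi {R d} f _ _.
Arguments primal {R d} f _.
Arguments pdof {R d} f _.

Section domain.
Variables (R : realType) (d N : nat) (Th : mesh R d N).
Implicit Types (i : 'I_N) (K L : elt Th) (G : pred (elt Th * 'I_d.+1)).

Definition Omega : set 'rV[R]_d :=
  (\bigcup_(K in [set: elt Th]) simplex (vtx K))°.

Definition bdOmega : set 'rV[R]_d := closure Omega `\` Omega.

(* The closure of the i-th subdomain. *)
Definition closed_subdomain i : set 'rV[R]_d :=
  \bigcup_(K in [set K : elt Th | dom K = i]) simplex (vtx K).

(* Vertices of K that are also vertices of L. *)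
Definition common_vertices K L : pred 'I_d.+1 :=
  fun k => [exists l, row k (vtx K) == row l (vtx L)].

Definition conforming_triangulation : Prop :=
  [/\ forall K, nondegenerate (vtx K),
      forall K L, K != L ->
        open_simplex (vtx K) `&` open_simplex (vtx L) = set0,
      forall K L, simplex (vtx K) `&` simplex (vtx L) =
        subsimplex (vtx K) (common_vertices K L) &
      connected Omega].

Definition mesh_size : R := \big[Num.max/0]_(K : elt Th) diam (simplex (vtx K)).

Definition shape_regular (sigma : R) : Prop :=
  forall K, diam (simplex (vtx K)) <= sigma * inradius (simplex (vtx K)).

Definition quasi_uniform (tau : R) : Prop :=
  forall K, mesh_size <= tau * diam (simplex (vtx K)).

(* The subdomains are convex polytopes, and the closures of two of them meet in
   a common face, possibly empty. *)
Definition coarse_partition : Prop :=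
  [/\ forall i, exists K, dom K = i,
      forall i, convex_set
        (closed_subdomain i : set (convex_lmodType 'rV[R]_d)) &
      forall i j, i != j ->
        is_face (closed_subdomain i `&` closed_subdomain j)
          (closed_subdomain i)].

(* The parts of the boundary are unions of boundary facets of the mesh; a part
   is given by a predicate on the facets (K, k), and the complementary part by
   the negation of this predicate. *)
Definition boundary_facet (Kk : elt Th * 'I_d.+1) : bool :=
  `[< facet (vtx Kk.1) Kk.2 `<=` bdOmega >].

Definition boundary_part G : set 'rV[R]_d :=
  \bigcup_(Kk in [set Kk | boundary_facet Kk && G Kk])
    facet (vtx Kk.1) Kk.2.

Definition boundary_part_measure G : R :=
  \sum_(Kk : elt Th * 'I_d.+1 | boundary_facet Kk && G Kk) facet_measure (vtx Kk.1) Kk.2.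

(* The integral over the i-th subdomain, element by element: the derivatives of
   finite element functions are piecewise polynomials, defined off the skeleton
   of the mesh, which is negligible. *)
Definition subdomain_integral i (f : 'rV[R]_d -> R) : R :=
  \sum_(K : elt Th | dom K == i) integral_rn (open_simplex (vtx K)) f.

Definition domain_integral (f : 'rV[R]_d -> R) : R :=
  \sum_i subdomain_integral i f.

Definition active (V : zmodType) (f : 'rV[R]_d -> V) i : bool :=
  `[< exists (K : elt Th) x, [/\ dom K = i, open_simplex (vtx K) x & f x <> 0] >].

Definition interior_dof (V : zmodType) (f : 'rV[R]_d -> V) : bool :=
  #|[pred i | active f i]| == 1%N.

(* Degrees of freedom shared by several subdomains. *)
Definition interface_dof (V : zmodType) (f : 'rV[R]_d -> V) : bool :=
  (1 < #|[pred i | active f i]|)%N.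

(* On each subdomain, the basis functions that do not vanish there are linearly
   independent. *)
Definition fe_basis (V : lmodType R) (n : nat)
    (f : 'I_n -> 'rV[R]_d -> V) : Prop :=
  (forall j, exists i, active (f j) i) /\
  (forall i (c : 'I_n -> R),
    (forall K x, dom K = i -> open_simplex (vtx K) x ->
      \sum_j c j *: f j x = 0) ->
    forall j, active (f j) i -> c j = 0).

(* Functions that are polynomial on each closed element are continuous, hence
   in H^1; polynomials on the open elements are only in L^2. *)
Definition h1_conforming (f : 'rV[R]_d -> R) : Prop :=
  forall K, polynomial_on (simplex (vtx K)) f.

Definition l2_conforming (f : 'rV[R]_d -> R) : Prop :=
  forall K, polynomial_on (open_simplex (vtx K)) f.

Section forms.
Variable co : coefficients R N.

(* A displacement is a family of vector fields, one per subdomain, since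
   partially assembled displacements may jump across the interface. *)
Definition displacement := 'I_N -> 'rV[R]_d -> 'rV[R]_d.
Definition pressure := 'rV[R]_d -> R.
Definition state := (displacement * pressure * pressure)%type.

Definition form_a (u v : displacement) : R :=
  \sum_i 2 * mu co i * subdomain_integral i
    (fun x => \sum_k \sum_l strain (u i) x k l * strain (v i) x k l).

Definition form_b (v : displacement) (xi : pressure) : R :=
  - \sum_i subdomain_integral i (fun x => divergence (v i) x * xi x).

Definition form_c (xi eta : pressure) : R :=
  \sum_i (lam co i)^-1 * subdomain_integral i (fun x => xi x * eta x).

Definition form_d (p eta : pressure) : R :=
  \sum_i alpha co / lam co i * subdomain_integral i (fun x => p x * eta x).

Definition form_e (p q : pressure) : R :=
  \sum_i subdomain_integral i (fun x =>
    kap co i * (\sum_k pderiv k p x * pderiv k q x)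
    + 2 * alpha co ^+ 2 / lam co i * (p x * q x)).

Definition form_K (x y : state) : R :=
  let: (u, xi, p) := x in
  let: (v, eta, q) := y in
  form_a u v + form_b v xi + form_b u eta - form_c xi eta
  + form_d p eta + form_d q xi - form_e p q.

End forms.

Definition h1_norm (v : 'rV[R]_d -> 'rV[R]_d) : R :=
  Num.sqrt (domain_integral (fun x => \sum_k (v x 0 k ^+ 2
    + \sum_l pderiv l (fun y => v y 0 k) x ^+ 2))).

Definition l2_norm (eta : pressure) : R :=
  Num.sqrt (domain_integral (fun x => eta x ^+ 2)).

Section spaces.
Variable fe : fe_data R d.

Definition spaceV : set ('rV[R]_d -> 'rV[R]_d) :=
  [set v | exists c : 'I_(dimV fe) -> R,
    v = fun x => \sum_j c j *: psi fe j x].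

Definition spaceW : set pressure :=
  [set eta | exists c : 'I_(dimW fe) -> R,
    eta = fun x => \sum_j c j * chi fe j x].

Definition inf_sup_constant : \bar R :=
  ereal_inf [set ereal_sup [set
      (domain_integral (fun x => divergence v x * eta x)
        / (h1_norm v * l2_norm eta))%:E
    | v in [set v | spaceV v /\ h1_norm v <> 0]]
  | eta in [set eta | spaceW eta /\ l2_norm eta <> 0]].

Definition stokes_stable (beta : R) : Prop :=
  0 < beta /\ (beta%:E <= inf_sup_constant)%E.

Definition fe_spaces (GD GP : pred (elt Th * 'I_d.+1)) : Prop :=
  [/\ fe_basis (psi fe) /\
        (forall j k, h1_conforming (fun x => psi fe j x 0 k)) /\
        (forall j x, boundary_part GD x -> psi fe j x = 0),
      fe_basis (V := R^o) (chi fe) /\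
        (forall j, l2_conforming (chi fe j)) &
      fe_basis (V := R^o) (phi fe) /\
        (forall j, h1_conforming (phi fe j)) /\
        (forall j x, boundary_part GP x -> phi fe j x = 0)].

Definition dof_support (dof : primal_dof R d) : set 'rV[R]_d :=
  match dof with
  | VertexDof x _ => [set x]
  | AverageDof F _ _ _ _ => F
  end.

Definition dof_value (dof : primal_dof R d) (v : 'rV[R]_d -> 'rV[R]_d) : R :=
  match dof with
  | VertexDof x k => v x 0 k
  | AverageDof F m A b k =>
      let F' := [set t : 'rV[R]_m | F (b + t *m A)] in
      integral_rn F' (fun t => v (b + t *m A) 0 k) / integral_rn F' (fun=> 1)
  end.

Definition subdomain_vertex i (x : 'rV[R]_d) : Prop :=
  is_face [set x] (closed_subdomain i).

(* In dimension 2 only vertices; in dimension 3 also the edges (m = 1) and the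
   faces (m = 2) of the subdomains. *)
Definition admissible_dof (dof : primal_dof R d) : Prop :=
  match dof with
  | VertexDof x _ => exists i, subdomain_vertex i x
  | AverageDof F m A b _ =>
      [/\ d = 3%N, m = 1%N \/ m = 2%N,
          exists i, is_face F (closed_subdomain i),
          row_free A /\ F `<=` range (fun t : 'rV[R]_m => b + t *m A) &
          [set t : 'rV[R]_m | F (b + t *m A)]° !=set0]
  end.

Definition primal_on i (j : 'I_(dimV fe)) : Prop :=
  primal fe j /\ dof_support (pdof fe j) `<=` closed_subdomain i.

(* The basis function [psi fe j] is dual if it is an interface function that is
   not primal. The restrictions to the i-th subdomain of the dual functions that
   do not vanish there form a basis of the local dual space; the last clause
   says that this space consists of the interface functions of the subdomain
   that vanish at its primal degrees of freedom. *)
Record primal_space (GD : pred (elt Th * 'I_d.+1)) : Prop := PrimalSpace {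
  primal_interface : forall j : 'I_(dimV fe), primal fe j ->
    interface_dof (psi fe j) /\ admissible_dof (pdof fe j);
  primal_local : forall (j : 'I_(dimV fe)) i,
    primal fe j -> active (psi fe j) i ->
    dof_support (pdof fe j) `<=` closed_subdomain i;
  primal_vertices : forall i i' x (k : 'I_d),
    i != i' -> subdomain_vertex i x -> closed_subdomain i' x ->
    ~ boundary_part GD x ->
    exists j : 'I_(dimV fe), primal fe j /\ pdof fe j = VertexDof x k;
  primal_vertex_nodal : forall (j j' : 'I_(dimV fe)) x (k : 'I_d),
    primal fe j -> primal fe j' -> pdof fe j = VertexDof x k ->
    psi fe j' x 0 k = (j' == j)%:R;
  primal_normalized : forall j : 'I_(dimV fe), primal fe j ->
    dof_value (pdof fe j) (psi fe j) = 1;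
  dual_local_space : forall i (c : 'I_(dimV fe) -> R),
    (forall j, primal_on i j -> dof_value (pdof fe j) (fun x =>
       \sum_(j' | interface_dof (psi fe j') &&
                  active (psi fe j') i) c j' *: psi fe j' x) = 0) <->
    (forall j, primal fe j -> active (psi fe j) i -> c j = 0)
}.

(* A rigid body motion of a subdomain that satisfies the essential boundary
   condition is determined by the primal degrees of freedom. *)
Definition controls_rigid_motions (GD : pred (elt Th * 'I_d.+1)) : Prop :=
  forall i (a : 'rV[R]_d) (S : 'M[R]_d), S^T = - S ->
    let r := fun x : 'rV[R]_d => a + x *m S in
    (forall x, closed_subdomain i x -> boundary_part GD x -> r x = 0) ->
    (forall j, primal_on i j -> dof_value (pdof fe j) r = 0) ->
    forall x, closed_subdomain i x -> r x = 0.

Definition idxVI : finType := {j : 'I_(dimV fe) | interior_dof (psi fe j)}.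
Definition idxWI : finType := {j : 'I_(dimW fe) | interior_dof (chi fe j)}.
Definition idxQI : finType := {j : 'I_(dimQ fe) | interior_dof (phi fe j)}.
Definition idxWG : finType := {j : 'I_(dimW fe) | interface_dof (chi fe j)}.
Definition idxQG : finType := {j : 'I_(dimQ fe) | interface_dof (phi fe j)}.
Definition idxVP : finType := {j : 'I_(dimV fe) | primal fe j}.

(* A dual degree of freedom has one copy per subdomain sharing it. *)
Definition idxVD : finType :=
  {ij : 'I_N * 'I_(dimV fe) |
    [&& interface_dof (psi fe ij.2), ~~ primal fe ij.2
      & active (psi fe ij.2) ij.1]}.

Definition idxA : finType := (idxVI + idxWI + idxQI + idxVD + idxVP)%type.

Definition basisA (s : idxA) : state :=
  match s with
  | inl (inl (inl (inl j))) => ((fun=> psi fe (val j)), (fun=> 0), (fun=> 0))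
  | inl (inl (inl (inr j))) => ((fun=> fun=> 0), chi fe (val j), (fun=> 0))
  | inl (inl (inr j)) => ((fun=> fun=> 0), (fun=> 0), phi fe (val j))
  | inl (inr ij) =>
      ((fun i => if i == (val ij).1 then psi fe (val ij).2 else fun=> 0),
       (fun=> 0), (fun=> 0))
  | inr j => ((fun=> psi fe (val j)), (fun=> 0), (fun=> 0))
  end.

Definition chiG (r : 'I_#|idxWG|) : pressure := chi fe (val (enum_val r)).
Definition phiG (r : 'I_#|idxQG|) : pressure := phi fe (val (enum_val r)).

(* [BD] evaluates the jumps of the dual displacements across the interface. *)
Definition jump_matrix (m : nat) (BD : 'M[R]_(m, #|idxVD|)) : Prop :=
  (forall l, exists s t, [/\ s != t, BD l s = 1, BD l t = -1 &
     forall r, r != s -> r != t -> BD l r = 0]) /\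
  (forall v : 'cV[R]_#|idxVD|, BD *m v = 0 <->
     forall s t : idxVD, (val s).2 = (val t).2 ->
       v (enum_rank s) 0 = v (enum_rank t) 0).

Definition in_Lambda (m : nat) (BD : 'M[R]_(m, #|idxVD|)) (l : 'cV[R]_m) :
    Prop :=
  exists v, l = BD *m v.

Variable co : coefficients R N.

Definition A_tilde : 'M[R]_#|idxA| :=
  \matrix_(r, s) form_K co (basisA (enum_val s)) (basisA (enum_val r)).

(* The third block is [BD] applied to the dual part of the argument. *)
Definition BC_tilde (m : nat) (BD : 'M[R]_(m, #|idxVD|)) :
    'M[R]_(#|idxWG| + #|idxQG| + m, #|idxA|) :=
  col_mx
    (col_mx
      (\matrix_(r, s) form_K co (basisA (enum_val s))
         ((fun=> fun=> 0), chiG r, (fun=> 0)))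
      (\matrix_(r, s) form_K co (basisA (enum_val s))
         ((fun=> fun=> 0), (fun=> 0), phiG r)))
    (\matrix_(l, s)
       if enum_val s is inl (inr ij) then BD l (enum_rank ij) else 0).

Definition C_GG : 'M[R]_#|idxWG| :=
  \matrix_(r, s) form_c co (chiG s) (chiG r).
Definition D_GG : 'M[R]_(#|idxQG|, #|idxWG|) :=
  \matrix_(r, s) form_d co (phiG r) (chiG s).
Definition E_GG : 'M[R]_#|idxQG| :=
  \matrix_(r, s) form_e co (phiG s) (phiG r).

Definition C_tilde (m : nat) : 'M[R]_(#|idxWG| + #|idxQG| + m) :=
  block_mx (block_mx (- C_GG) D_GG^T D_GG (- E_GG)) 0 0 0.

Definition interface_matrix (m : nat) (BD : 'M[R]_(m, #|idxVD|)) :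
    'M[R]_(#|idxWG| + #|idxQG| + m) :=
  BC_tilde BD *m invmx A_tilde *m (BC_tilde BD)^T - C_tilde m.

End spaces.
End domain.

(* Main.v *)
Require Import Defs.
From mathcomp Require Import all_boot all_order all_algebra.
From mathcomp Require Import all_classical all_reals all_analysis.
From mathcomp Require mpoly.
From mathcomp Require Import ring.
Import Order.TTheory GRing.Theory Num.Theory.
Import numFieldNormedType.Exports.
Local Open Scope classical_set_scope.
Local Open Scope ring_scope.

(** Let E be the energy form
      a(u, v) + c(xi, eta) - d(p, eta) - d(q, xi) + e(p, q)
    on triples (displacement, total pressure, pressure). Its diagonal is a sum
    over the elements of integrals of squares with positive weights: the strain,
    the gradient of p, and, after completing the square,
      c(xi, xi) - 2 d(p, xi) + 2 (alpha^2 / lambda) |p|^2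
        = |xi - alpha p|^2 / lambda + (alpha^2 / lambda) |p|^2.

    The form K agrees with E on pairs of displacements and with - E on pairs of
    pressures. Hence, if the test function is taken to be the trial function
    with the sign of the pressures reversed, the coupling terms b cancel and K
    becomes E ([saddle_energy]).

    Given x = (xi_Gamma, p_Gamma, l), let y = - A^-1 B_C^T x, and let z collect
    y, xi_Gamma and p_Gamma. The vector y solves the subdomain problems with
    data x, that is K(z, v) = - l . J v for every v indexing A, where J is the
    jump of the dual displacements ([interior_equation]). Testing with z, with
    the sign of its pressures reversed, gives x^T G x = E(z, z) >= 0
    ([interface_quadratic]).

    If E(z, z) = 0, each square vanishes on each element: p and xi are zero as
    functions, so their coefficients are zero by the local linear independence
    of the bases, and the displacement part lies in the kernel of a. The
    equation for y then reduces to J^T l = 0. Since l is in the range of J, l is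
    orthogonal to itself, so l = 0 ([interface_quadratic_gt0]).

    The analytic part consists in showing that all integrands are polynomial on
    open simplices, so that integration is linear on them and that the integral
    of a nonnegative one vanishes only if it is zero ([integral_rn_eq0]). *)

Set Implicit Arguments.
Unset Strict Implicit.

(** * Polynomial functions *)

Section PolynomialFunctions.
Variables (R : realType) (n : nat).
Implicit Types f g : 'rV[R]_n -> R.

(** The inductive form gives differentiability, measurability and boundedness by
    induction on the construction of the function. *)
Inductive polyfun : ('rV[R]_n -> R) -> Prop :=
| polyfun_cst c : polyfun (fun=> c)
| polyfun_coord k : polyfun (fun x => x 0 k)
| polyfunD f g : polyfun f -> polyfun g -> polyfun (fun x => f x + g x)
| polyfunM f g : polyfun f -> polyfun g -> polyfun (fun x => f x * g x).

Lemma polyfun_sum (I : Type) (r : seq I) (F : I -> 'rV[R]_n -> R) :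
  (forall i, polyfun (F i)) -> polyfun (fun x => \sum_(i <- r) F i x).
Proof.
move=> pF; elim: r => [|i r IHr].
  by under eq_fun do rewrite big_nil; exact: polyfun_cst.
by under eq_fun do rewrite big_cons; exact: polyfunD.
Qed.

Lemma polyfun_prod (I : Type) (r : seq I) (F : I -> 'rV[R]_n -> R) :
  (forall i, polyfun (F i)) -> polyfun (fun x => \prod_(i <- r) F i x).
Proof.
move=> pF; elim: r => [|i r IHr].
  by under eq_fun do rewrite big_nil; exact: polyfun_cst.
by under eq_fun do rewrite big_cons; exact: polyfunM.
Qed.

Lemma polyfunX f m : polyfun f -> polyfun (fun x => f x ^+ m).
Proof.
move=> pf; elim: m => [|m IHm]; first exact: polyfun_cst.
by under eq_fun do rewrite exprS; exact: polyfunM.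
Qed.

Lemma polyfun_meval (p : mpoly.mpoly n R) :
  polyfun (fun x => mpoly.meval (fun k => x 0 k) p).
Proof.
under eq_fun do rewrite mpoly.mevalE.
apply: polyfun_sum => m; apply: polyfunM; first exact: polyfun_cst.
by apply: polyfun_prod => k; apply: polyfunX; exact: polyfun_coord.
Qed.

Lemma polyfun_differentiable f x : polyfun f -> differentiable f x.
Proof.
elim=> [c|k|{}f g _ df _ dg|{}f g _ df _ dg].
- exact: differentiable_cst.
- exact: differentiable_coord.
- exact: differentiableD.
- exact: differentiableM.
Qed.

Lemma polyfun_continuous f : polyfun f -> continuous f.
Proof. by move=> pf x; exact/differentiable_continuous/polyfun_differentiable. Qed.

Lemma polyfun_derive f v : polyfun f -> polyfun (fun x => 'D_v f x).
Proof.
have pd g x : polyfun g -> derivable g x v.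
  by move=> pg; exact/diff_derivable/polyfun_differentiable.
elim=> [c|k|{}f g pf df pg dg|{}f g pf df pg dg].
- rewrite (_ : (fun x => _) = cst (0 : R)); first exact: (polyfun_cst 0).
  by apply/funext => x; exact: derive_cst.
- rewrite (_ : (fun x => _) = cst (v 0 k)); first exact: (polyfun_cst (v 0 k)).
  apply/funext => x; apply: cvg_lim => //.
  apply: cvg_near_cst; near=> h.
  rewrite /= !mxE addrK scalerA mulVf ?scale1r//.
  by near: h; exact: nbhs_dnbhs_neq.
- rewrite (_ : (fun x => _) = fun x => 'D_v f x + 'D_v g x); first exact: polyfunD.
  by apply/funext => x; apply: deriveD; exact: pd.
- rewrite (_ : (fun x => _) = fun x => f x * 'D_v g x + g x * 'D_v f x).
    by apply: polyfunD; exact: polyfunM.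
  by apply/funext => x; apply: deriveM; exact: pd.
Unshelve. all: by end_near. Qed.

Lemma polyfun_measurable f : polyfun f -> measurable_fun setT (f \o @pt R n).
Proof.
elim=> [c|k|{}f g _ mf _ mg|{}f g _ mf _ mg].
- exact: measurable_cst.
- rewrite (_ : _ \o _ = fun t => tnth t k); first exact: measurable_tnth.
  by apply/funext => t; rewrite /= mxE.
- exact: measurable_realfun.measurable_funD.
- exact: measurable_realfun.measurable_funM.
Qed.

(** Applied to a box containing a simplex; together with the finite measure of the
    box, the bound gives integrability over the simplex. *)
Lemma polyfun_bounded f (B : R) : polyfun f ->
  exists C, forall x : 'rV[R]_n, (forall k, `|x 0 k| <= B) -> `|f x| <= C.
Proof.
elim=> [c|k|{}f g _ [C hC] _ [D hD]|{}f g _ [C hC] _ [D hD]].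
- by exists `|c|.
- by exists B.
- exists (C + D) => x xB; rewrite (le_trans (ler_normD _ _))// lerD//.
  + exact: hC.
  + exact: hD.
- exists (C * D) => x xB; rewrite normrM ler_pM//.
  + exact: hC.
  + exact: hD.
Qed.

End PolynomialFunctions.

(** * The Lebesgue measure of a box *)

Section BoxMeasure.
Variable R : realType.

(** Open cubes, which are also the balls of the norm of row vectors; [lebesgue_rn]
    is handled only through their measure, which bounds the measure of a simplex
    from above and that of a nonempty open set from below. *)
Definition box n (a : 'rV[R]_n) (e : R) : set (n.-tuple (measurableTypeR R)) :=
  [set t | forall k, ball (a 0 k) e (tnth t k)].

Lemma measurable_box n (a : 'rV[R]_n) e : measurable (box a e).
Proof.
rewrite (_ : box a e = \bigcap_(k in setT) ((fun t => tnth t k) @^-1` ball (a 0 k) e)).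
  apply: fin_bigcap_measurable => // k _; rewrite -[X in measurable X]setTI.
  by apply: measurable_tnth => //; exact: measurable_realfun.measurable_ball.
by apply/seteqP; split => t /= h k; [move=> _|]; exact: h.
Qed.

Lemma lebesgue_rn_box n (a : 'rV[R]_n) e : 0 <= e ->
  lebesgue_rn R n (box a e) = ((e *+ 2) ^+ n)%:E.
Proof.
move=> e0; elim: n a => [|n IHn] a /=.
  by rewrite diracE mem_set// => -[].
rewrite /product_cons.
rewrite (_ : _ @^-1` _ = ball (a 0 0) e `*` box (\row_k a 0 (lift 0 k)) e).
  rewrite product_measure1E//.
  - rewrite exprS EFinM IHn; congr (_ * _)%E; exact: lebesgue_measure_ball.
  - exact: measurable_realfun.measurable_ball.
  - exact: measurable_box.
apply/seteqP; split => [[x t] /= h|[x t] /= [hx ht] k].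
  split; first by have := h ord0.
  by move=> k; rewrite mxE; have := h (lift ord0 k); rewrite tnthS.
case: (unliftP ord0 k) => [j|] ->; last by [].
by rewrite tnthS; have := ht j; rewrite mxE.
Qed.

End BoxMeasure.

(** * Integration over an open simplex *)

Section SimplexIntegral.
Variables (R : realType) (d : nat) (V : 'M[R]_(d.+1, d)).
Hypothesis nV : Defs.nondegenerate V.
Implicit Types f g : 'rV[R]_d -> R.

(** A point x = c *m V with coordinates c of sum 1 satisfies
   (1, x) = c *m (1 | V), which is solved for c. *)
Let barycentric (x : 'rV[R]_d) : 'rV[R]_d.+1 :=
  row_mx (const_mx 1 : 'rV[R]_1) x *m invmx (row_mx (const_mx 1) V : 'M[R]_(1 + d)).

Lemma open_simplexP x : open_simplex V x <-> forall k, 0 < barycentric x 0 k.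
Proof.
have mulV1 (c : 'rV[R]_d.+1) : c *m (const_mx 1 : 'cV[R]_d.+1) = const_mx (\sum_k c 0 k).
  by apply/matrixP => i j; rewrite !mxE; apply: eq_bigr => k _; rewrite !mxE ord1 mulr1.
split=> [[c [c0 c1 ->]] k|x0].
  have -> : barycentric (c *m V) = c.
    rewrite /barycentric (_ : row_mx _ _ = c *m row_mx (const_mx 1) V).
      by rewrite mulmxK.
    by rewrite mul_mx_row mulV1 c1.
  exact: c0.
have E : barycentric x *m row_mx (const_mx 1) V = row_mx (const_mx 1 : 'rV[R]_1) x.
  by rewrite /barycentric mulmxKV.
exists (barycentric x); split=> //; move: E; rewrite mul_mx_row => /eq_row_mx[].
  by rewrite mulV1 => /matrixP/(_ 0 0); rewrite !mxE.
by move=> _ /esym.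
Qed.

Lemma polyfun_barycentric k : polyfun (fun x => barycentric x 0 k).
Proof.
under eq_fun do rewrite mxE.
apply: polyfun_sum => j; apply: polyfunM; last exact: polyfun_cst.
case: (split_ordP j) => i ->.
  by under eq_fun do rewrite row_mxEl mxE; exact: polyfun_cst.
by under eq_fun do rewrite row_mxEr; exact: polyfun_coord.
Qed.

(** The simplex is given by strict inequalities between affine functions of the
    point, by [open_simplexP]; the same description makes it measurable. *)
Lemma open_open_simplex : open (open_simplex V).
Proof.
rewrite openE => x /open_simplexP Vx.
rewrite /interior; near=> y; apply/open_simplexP; near: y.
apply: filter_forall => k.
have : (fun y => barycentric y 0 k) @ x --> barycentric x 0 k.
  exact: (polyfun_continuous (polyfun_barycentric k)).
by move=> /cvgr_gt; apply; exact: Vx.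
Unshelve. all: by end_near. Qed.

Let S : set (d.-tuple (measurableTypeR R)) := [set t | open_simplex V (pt t)].

Lemma measurable_open_simplex : measurable S.
Proof.
rewrite (_ : S = \bigcap_(k in setT)
    (((fun x => barycentric x 0 k) \o @pt R d) @^-1` `]0, +oo[%classic)).
  apply: fin_bigcap_measurable => // k _; rewrite -[X in measurable X]setTI.
  apply: polyfun_measurable => //; exact: polyfun_barycentric.
apply/seteqP; split => x /=.
  by move=> /open_simplexP h k _; rewrite /= in_itv/= andbT; exact: h.
by move=> h; apply/open_simplexP => k; have := h k I; rewrite /= in_itv/= andbT.
Qed.

Lemma open_simplex_bounded :
  exists B, forall x, open_simplex V x -> forall k, `|x 0 k| <= B.
Proof.
exists (\sum_i \sum_j `|V i j|) => x [c [c0 c1 ->]] k.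
rewrite mxE (le_trans (ler_norm_sum _ _ _))// ler_sum// => i _.
rewrite normrM (@le_trans _ _ `|V i k|)//.
  rewrite ler_piMl// gtr0_norm// -c1 (bigD1 i)//= lerDl.
  by apply: sumr_ge0 => j _; exact: ltW.
by rewrite (bigD1 k)//= lerDl; apply: sumr_ge0.
Qed.

Lemma open_simplex_finite : (lebesgue_rn R d S < +oo)%E.
Proof.
have [B hB] := open_simplex_bounded.
apply: le_lt_trans (ltry (((`|B| + 1) *+ 2) ^+ d)).
rewrite -(lebesgue_rn_box 0) ?addr_ge0//; apply: le_measure; rewrite ?inE.
- exact: measurable_open_simplex.
- exact: measurable_box.
- move=> t /hB tB k; have := tB k; rewrite !mxE => tk.
  by rewrite /ball/= sub0r normrN (le_lt_trans tk)// ltr_pwDr// ler_norm.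
Qed.

(** The integrands below are derivatives of functions that are piecewise
    polynomial: they are polynomial only in the interior of each element, their
    values on the skeleton being arbitrary. *)
Definition polyfun_on f :=
  exists2 g, polyfun g & forall x, open_simplex V x -> f x = g x.

Lemma polyfun_on_cst c : polyfun_on (fun=> c).
Proof. by exists (fun=> c) => //; exact: polyfun_cst. Qed.

Lemma polyfun_onD f g :
  polyfun_on f -> polyfun_on g -> polyfun_on (fun x => f x + g x).
Proof.
move=> [f' pf ff'] [g' pg gg']; exists (fun x => f' x + g' x).
  exact: polyfunD.
by move=> x Vx; rewrite ff'// gg'.
Qed.

Lemma polyfun_onM f g :
  polyfun_on f -> polyfun_on g -> polyfun_on (fun x => f x * g x).
Proof.
move=> [f' pf ff'] [g' pg gg']; exists (fun x => f' x * g' x).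
  exact: polyfunM.
by move=> x Vx; rewrite ff'// gg'.
Qed.

Lemma polyfun_onZ c f : polyfun_on f -> polyfun_on (fun x => c * f x).
Proof. by apply: polyfun_onM; exact: polyfun_on_cst. Qed.

Lemma polyfun_on_sum (I : Type) (r : seq I) (F : I -> 'rV[R]_d -> R) :
  (forall i, polyfun_on (F i)) -> polyfun_on (fun x => \sum_(i <- r) F i x).
Proof.
move=> pF; elim: r => [|i r IHr].
  by under eq_fun do rewrite big_nil; exact: polyfun_on_cst.
by under eq_fun do rewrite big_cons; exact: polyfun_onD.
Qed.

Lemma polynomial_on_polyfun_on f :
  polynomial_on (open_simplex V) f -> polyfun_on f.
Proof.
by move=> [p fp]; exists (fun x => mpoly.meval (fun k => x 0 k) p) => //;
  exact: polyfun_meval.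
Qed.

Lemma open_simplex_sub : open_simplex V `<=` simplex V.
Proof. by move=> x [c [c0 c1 ->]]; exists c; split => // k; exact: ltW. Qed.

(** Derivatives are local and the simplex is open. *)
Lemma polyfun_on_pderiv k f :
  polyfun_on f -> polyfun_on (pderiv k f).
Proof.
move=> [g pg fg]; exists (pderiv k g); first exact: polyfun_derive.
move=> x Vx; apply: near_eq_derive.
have : nbhs x (open_simplex V) by apply: open_nbhs_nbhs; split => //; exact: open_open_simplex.
by apply: filterS => y; exact: fg.
Qed.

Lemma polyfun_on_integrable f : polyfun_on f ->
  (lebesgue_rn R d).-integrable S (EFin \o (f \o @pt R d)).
Proof.
move=> [g pg fg]; apply: (@eq_integrable _ _ _ _ _ _ (EFin \o (g \o @pt R d))).
- exact: measurable_open_simplex.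
- by move=> t /set_mem St /=; rewrite fg.
have [B hB] := open_simplex_bounded; have [C hC] := polyfun_bounded B pg.
apply: measurable_bounded_integrable.
- exact: measurable_open_simplex.
- exact: open_simplex_finite.
- apply: measurable_funS (polyfun_measurable pg) => //.
- exists C; split; first exact: num_real.
  move=> D CD t /= St; rewrite (le_trans _ (ltW CD))// hC//.
  exact: hB.
Qed.

Lemma integral_rn_ext f g : (forall x, open_simplex V x -> f x = g x) ->
  integral_rn (open_simplex V) f = integral_rn (open_simplex V) g.
Proof. by move=> fg; apply: eq_Rintegral => t /set_mem St; exact: fg. Qed.

Lemma integral_rnD f g : polyfun_on f -> polyfun_on g ->
  integral_rn (open_simplex V) (fun x => f x + g x) =
  integral_rn (open_simplex V) f + integral_rn (open_simplex V) g.
Proof.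
move=> pf pg; rewrite /integral_rn RintegralD//.
- exact: measurable_open_simplex.
- exact: polyfun_on_integrable.
- exact: polyfun_on_integrable.
Qed.

Lemma integral_rnZ c f : polyfun_on f ->
  integral_rn (open_simplex V) (fun x => c * f x) =
  c * integral_rn (open_simplex V) f.
Proof.
move=> pf; rewrite /integral_rn RintegralZl//.
- exact: measurable_open_simplex.
- exact: polyfun_on_integrable.
Qed.

Lemma integral_rn_sum (I : Type) (r : seq I) (F : I -> 'rV[R]_d -> R) :
  (forall i, polyfun_on (F i)) ->
  integral_rn (open_simplex V) (fun x => \sum_(i <- r) F i x)
  = \sum_(i <- r) integral_rn (open_simplex V) (F i).
Proof.
move=> pF; elim: r => [|i r IHr].
  rewrite big_nil; under integral_rn_ext do rewrite big_nil.
  by rewrite /integral_rn /Rintegral integral0.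
rewrite big_cons -IHr; under integral_rn_ext do rewrite big_cons.
by apply: integral_rnD => //; exact: polyfun_on_sum.
Qed.

Lemma integral_rn_ge0 f : (forall x, open_simplex V x -> 0 <= f x) ->
  0 <= integral_rn (open_simplex V) f.
Proof. by move=> f0; apply: Rintegral_ge0 => t St; exact: f0. Qed.

(** The integrand vanishes almost everywhere; if it did not vanish at x, it would
    by continuity be nonzero in a box around x inside the simplex, and this box
    has positive measure. *)
Lemma integral_rn_eq0 f : polyfun_on f ->
  (forall x, open_simplex V x -> 0 <= f x) ->
  integral_rn (open_simplex V) f = 0 ->
  forall x, open_simplex V x -> f x = 0.
Proof.
move=> pf f0 If0 x Vx; have [g pg fg] := pf.
have intf := polyfun_on_integrable pf.
have : (\int[lebesgue_rn R d]_(t in S) `|(EFin \o (f \o @pt R d)) t| = 0)%E.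
  rewrite (eq_integral (EFin \o (f \o @pt R d))).
    apply/eqP; rewrite -fine_eq0; first exact/eqP.
    by apply: integrable_fin_num => //; exact: measurable_open_simplex.
  by move=> t /set_mem St /=; rewrite ger0_norm// f0.
move/ae_eq_integral_abs => /(_ measurable_open_simplex (measurable_int _ intf)).
move=> [Z [mZ Z0 subZ]].
apply: contrapT => /eqP fx0.
have : nbhs x (open_simplex V `&` [set y | g y != 0]).
  apply: filterI.
    by apply: open_nbhs_nbhs; split => //; exact: open_open_simplex.
  have : g @ x --> g x by exact: (polyfun_continuous pg).
  by move=> /cvgr_neq0; apply; rewrite -fg.
move=> /nbhs_ballP[e /= e0 esub].
have boxZ : box x e `<=` Z.
  move=> t bt; apply: subZ => /= h.
  have [|Vt /= /eqP gt0] := esub (pt t).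
    by split=> // i j; rewrite ord1 mxE; exact: bt.
  by have [] := h Vt; rewrite fg.
have : lebesgue_rn R d (box x e) = 0%E.
  by apply: subset_measure0 Z0 => //; exact: measurable_box.
rewrite lebesgue_rn_box ?ltW// => -[/eqP]; rewrite expf_eq0 => /andP[_].
by rewrite mulrn_eq0/= gt_eqF.
Qed.

End SimplexIntegral.

(** * The bilinear forms, element by element *)

Section Forms.
Variables (R : realType) (d N : nat) (Th : mesh R d N) (co : coefficients R N).
Implicit Types (u v : displacement R d N) (xi eta p q : pressure R d).
Implicit Types (s t : state R d N) (K : elt Th).

Local Notation elt_int K f := (integral_rn (open_simplex (vtx (m := Th) K)) f).

Lemma sum_subdomain_integral (c : 'I_N -> R) (f : 'I_N -> 'rV[R]_d -> R) :
  \sum_i c i * subdomain_integral Th i (f i) =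
  \sum_(K : elt Th) c (dom K) * elt_int K (f (dom K)).
Proof.
rewrite [RHS](partition_big (@dom _ _ _ Th) predT)//=.
apply: eq_bigr => i _; rewrite mulr_sumr; apply: eq_bigr => K /eqP Ki.
by rewrite Ki.
Qed.

Lemma form_aE u v : form_a Th co u v = \sum_(K : elt Th) 2 * mu co (dom K) *
  elt_int K (fun x => \sum_k \sum_l strain (u (dom K)) x k l * strain (v (dom K)) x k l).
Proof. exact: (sum_subdomain_integral (fun i => 2 * mu co i)). Qed.

Lemma form_bE v xi : form_b Th v xi =
  - \sum_(K : elt Th) elt_int K (fun x => divergence (v (dom K)) x * xi x).
Proof.
rewrite /form_b; congr (- _).
under eq_bigr do rewrite -[subdomain_integral _ _ _]mul1r.
under [RHS]eq_bigr do rewrite -[integral_rn _ _]mul1r.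
exact: (sum_subdomain_integral (fun=> 1)).
Qed.

Lemma form_cE xi eta : form_c Th co xi eta =
  \sum_(K : elt Th) (lam co (dom K))^-1 * elt_int K (fun x => xi x * eta x).
Proof. exact: sum_subdomain_integral. Qed.

Lemma form_dE p eta : form_d Th co p eta =
  \sum_(K : elt Th) alpha co / lam co (dom K) * elt_int K (fun x => p x * eta x).
Proof. exact: (sum_subdomain_integral (fun i => alpha co / lam co i)). Qed.

Lemma form_eE p q : form_e Th co p q = \sum_(K : elt Th) elt_int K (fun x =>
    kap co (dom K) * (\sum_k pderiv k p x * pderiv k q x)
    + 2 * alpha co ^+ 2 / lam co (dom K) * (p x * q x)).
Proof.
rewrite /form_e.
under eq_bigr do rewrite -[subdomain_integral _ _ _]mul1r.
under [RHS]eq_bigr do rewrite -[integral_rn _ _]mul1r.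
by rewrite (sum_subdomain_integral (fun=> 1)).
Qed.

Lemma form_a_sym u v : form_a Th co u v = form_a Th co v u.
Proof.
rewrite !form_aE; apply: eq_bigr => K _; congr (_ * _).
apply: integral_rn_ext => x _; apply: eq_bigr => k _; apply: eq_bigr => l _.
exact: mulrC.
Qed.

Lemma form_c_sym xi eta : form_c Th co xi eta = form_c Th co eta xi.
Proof.
rewrite !form_cE; apply: eq_bigr => K _; congr (_ * _).
by apply: integral_rn_ext => x _; exact: mulrC.
Qed.

Lemma form_e_sym p q : form_e Th co p q = form_e Th co q p.
Proof.
rewrite !form_eE; apply: eq_bigr => K _.
apply: integral_rn_ext => x _; rewrite [p x * _]mulrC; congr (_ * _ + _).
by apply: eq_bigr => k _; exact: mulrC.
Qed.

Lemma form_K_sym s t : form_K Th co s t = form_K Th co t s.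
Proof.
case: s t => [[u xi] p] [[v eta] q]; rewrite /form_K.
by rewrite form_a_sym form_c_sym form_e_sym; ring.
Qed.

Lemma integral_rn0 K f : (forall x, f x = 0) -> elt_int K f = 0.
Proof.
move=> f0; rewrite (integral_rn_ext (g := fun=> 0)); last by move=> x _; exact: f0.
by rewrite /integral_rn /Rintegral integral0.
Qed.

Lemma pderiv0 k (x : 'rV[R]_d) : pderiv k (fun=> 0 : R) x = 0.
Proof. exact: derive_cst. Qed.

Lemma pderiv0_coord k l (x : 'rV[R]_d) :
  pderiv k (fun=> (0 : 'rV[R]_d) 0 l) x = 0.
Proof. exact: derive_cst. Qed.

(** By [form_a0] and the following lemmas, the terms of K decouple on states with
    only a displacement or only pressures. *)
Lemma form_a0 v : form_a Th co (fun=> fun=> 0) v = 0.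
Proof.
rewrite form_aE big1// => K _; rewrite integral_rn0 ?mulr0// => x.
rewrite big1// => k _; rewrite big1// => l _.
by rewrite /strain !pderiv0_coord addr0 !mul0r.
Qed.

Lemma form_b0l xi : form_b Th (fun=> fun=> 0 : 'rV[R]_d) xi = 0.
Proof.
rewrite form_bE big1 ?oppr0// => K _; rewrite integral_rn0// => x.
rewrite /divergence big1 ?mul0r// => k _; exact: pderiv0_coord.
Qed.

Lemma form_b0r v : form_b Th v (fun=> 0) = 0.
Proof.
by rewrite form_bE big1 ?oppr0// => K _; rewrite integral_rn0// => x; rewrite mulr0.
Qed.

Lemma form_c0 eta : form_c Th co (fun=> 0) eta = 0.
Proof.
by rewrite form_cE big1// => K _; rewrite integral_rn0 ?mulr0// => x; rewrite mul0r.
Qed.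

Lemma form_d0l eta : form_d Th co (fun=> 0) eta = 0.
Proof.
by rewrite form_dE big1// => K _; rewrite integral_rn0 ?mulr0// => x; rewrite mul0r.
Qed.

Lemma form_d0r p : form_d Th co p (fun=> 0) = 0.
Proof.
by rewrite form_dE big1// => K _; rewrite integral_rn0 ?mulr0// => x; rewrite mulr0.
Qed.

Lemma form_e0 q : form_e Th co (fun=> 0) q = 0.
Proof.
rewrite form_eE big1// => K _; rewrite integral_rn0// => x.
by rewrite mul0r mulr0 addr0 big1 ?mulr0// => k _; rewrite pderiv0 mul0r.
Qed.

(** * The energy form *)

(** K with the coupling b dropped and the sign of the pressure block reversed. *)
Definition energy s t : R :=
  let: (u, xi, p) := s in
  let: (v, eta, q) := t in
  form_a Th co u v
  + (form_c Th co xi eta - form_d Th co p eta - form_d Th co q xi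
     + form_e Th co p q).

Definition displacement_state s := s.1.2 = (fun=> 0) /\ s.2 = (fun=> 0).
Definition pressure_state s := s.1.1 = (fun=> fun=> 0).

Lemma form_K_dd s t : displacement_state s -> displacement_state t ->
  form_K Th co s t = energy s t.
Proof.
case: s t => [[u xi] p] [[v eta] q] [/= -> ->] [/= -> ->].
by rewrite /form_K /energy !form_b0r form_c0 form_d0l form_e0; ring.
Qed.

Lemma energy_dp s t : displacement_state s -> pressure_state t ->
  energy s t = 0.
Proof.
case: s t => [[u xi] p] [[v eta] q] [/= -> ->]; rewrite /pressure_state /= => ->.
by rewrite /energy form_a_sym form_a0 form_c0 form_d0l form_d0r form_e0; ring.
Qed.

Lemma energy_sym s t : energy s t = energy t s.
Proof.
case: s t => [[u xi] p] [[v eta] q]; rewrite /energy.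
by rewrite form_a_sym form_c_sym form_e_sym; ring.
Qed.

Lemma form_K_pp s t : pressure_state s -> pressure_state t ->
  form_K Th co s t = - energy s t.
Proof.
case: s t => [[u xi] p] [[v eta] q]; rewrite /pressure_state /= => -> ->.
by rewrite /form_K /energy form_a0 !form_b0l; ring.
Qed.

Hypothesis nK : forall K, Defs.nondegenerate (vtx K).
Hypothesis co_gt0 : positive_coefficients co.

Definition smooth_state s := forall K,
  [/\ forall i l, polyfun_on (vtx K) (fun y => s.1.1 i y 0 l),
      polyfun_on (vtx K) s.1.2 & polyfun_on (vtx K) s.2].

(** The energy density on an element is a positive combination of squares of
    features, which are linear in the state: components of the strain, components
    of the gradient of p, then [true] for xi - alpha p and [false] for p. *)
Definition feature_index : finType := ('I_d * 'I_d + 'I_d + bool)%type.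

Definition weight K (w : feature_index) : R :=
  match w with
  | inl (inl _) => 2 * mu co (dom K)
  | inl (inr _) => kap co (dom K)
  | inr true => (lam co (dom K))^-1
  | inr false => alpha co ^+ 2 / lam co (dom K)
  end.

Definition feature K (w : feature_index) s : 'rV[R]_d -> R :=
  match w with
  | inl (inl kl) => fun x => strain (s.1.1 (dom K)) x kl.1 kl.2
  | inl (inr k) => pderiv k s.2
  | inr true => fun x => s.1.2 x + - alpha co * s.2 x
  | inr false => s.2
  end.

Lemma weight_gt0 K w : 0 < weight K w.
Proof.
have [h a0] := co_gt0; have [l0 m0 k0] := h (dom K).
by case: w => [[_|_]|[]] /=; rewrite ?mulr_gt0 ?invr_gt0 ?exprn_gt0.
Qed.

Lemma smooth_feature K w s : smooth_state s -> polyfun_on (vtx K) (feature K w s).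
Proof.
move=> /(_ K)[su sxi sp]; case: w => [[[k l]|k]|[]] /=.
- apply: polyfun_onM; last exact: polyfun_on_cst.
  by apply: polyfun_onD; apply: polyfun_on_pderiv => //; exact: nK.
- by apply: polyfun_on_pderiv => //; exact: nK.
- by apply: polyfun_onD => //; exact: polyfun_onZ.
- exact: sp.
Qed.

(** The weight of [inr true] contributes alpha^2 / lambda to the coefficient of
    p q, and the weight of [inr false] the other half of 2 alpha^2 / lambda. *)
Lemma energyE s t : smooth_state s -> smooth_state t ->
  energy s t = \sum_(K : elt Th) \sum_w
    weight K w * elt_int K (fun x => feature K w s x * feature K w t x).
Proof.
move=> ss st; have fs K w := smooth_feature K w ss.
have ft K w := smooth_feature K w st.
transitivity (\sum_(K : elt Th) (
    2 * mu co (dom K) * elt_int K (fun x => \sum_k \sum_l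
      strain (s.1.1 (dom K)) x k l * strain (t.1.1 (dom K)) x k l)
    + ((lam co (dom K))^-1 * elt_int K (fun x => s.1.2 x * t.1.2 x)
      - alpha co / lam co (dom K) * elt_int K (fun x => s.2 x * t.1.2 x)
      - alpha co / lam co (dom K) * elt_int K (fun x => t.2 x * s.1.2 x)
      + elt_int K (fun x =>
         kap co (dom K) * (\sum_k pderiv k s.2 x * pderiv k t.2 x)
         + 2 * alpha co ^+ 2 / lam co (dom K) * (s.2 x * t.2 x))))).
  rewrite !big_split/= !sumrN -form_aE -form_cE -!form_dE -form_eE.
  by case: s t {ss st fs ft} => [[u xi] p] [[v eta] q].
apply: eq_bigr => K _; have [_ sxi sp] := ss K; have [_ txi tp] := st K.
rewrite big_sumType/= big_sumType/= big_bool/= -!mulr_sumr.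
have -> : elt_int K (fun x => \sum_k \sum_l
      strain (s.1.1 (dom K)) x k l * strain (t.1.1 (dom K)) x k l) =
    \sum_(kl : 'I_d * 'I_d) elt_int K (fun x =>
      strain (s.1.1 (dom K)) x kl.1 kl.2 * strain (t.1.1 (dom K)) x kl.1 kl.2).
  under integral_rn_ext do rewrite pair_big/=.
  apply: integral_rn_sum; first exact: nK.
  move=> kl; apply: polyfun_onM.
    exact: (fs K (inl (inl kl))).
  exact: (ft K (inl (inl kl))).
have psp k := polyfun_onM (fs K (inl (inr k))) (ft K (inl (inr k))).
rewrite (integral_rnD (nK K)) ?(integral_rnZ (nK K)) ?(integral_rn_sum (nK K))//.
- have -> : elt_int K (fun x => (s.1.2 x + - alpha co * s.2 x) *
      (t.1.2 x + - alpha co * t.2 x)) =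
    elt_int K (fun x => s.1.2 x * t.1.2 x) - alpha co * elt_int K (fun x => s.2 x * t.1.2 x)
    - alpha co * elt_int K (fun x => t.2 x * s.1.2 x)
    + alpha co ^+ 2 * elt_int K (fun x => s.2 x * t.2 x).
    under integral_rn_ext => x _.
      rewrite (_ : _ * _ = s.1.2 x * t.1.2 x + (- alpha co * (s.2 x * t.1.2 x)
       + (- alpha co * (t.2 x * s.1.2 x) + alpha co ^+ 2 * (s.2 x * t.2 x)))); last by ring.
      over.
    have [h1 [h2 [h3 h4]]] := (polyfun_onM sxi txi, (polyfun_onM sp txi,
      (polyfun_onM tp sxi, polyfun_onM sp tp))).
    do 3 (rewrite (integral_rnD (nK K)) ?(integral_rnZ (nK K))//;
      do ?[apply: polyfun_onD|apply: polyfun_onZ] => //).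
    by ring.
  by ring.
- exact: polyfun_onM.
- exact: polyfun_on_sum.
- by apply: polyfun_onZ; exact: polyfun_on_sum.
- by apply: polyfun_onZ; exact: polyfun_onM.
Qed.

Section Gram.
Variables (T : finType) (st : T -> state R d N) (z : T -> R).
Hypothesis st_smooth : forall j : T, smooth_state (st j).

(** The energy of a combination of states is computed from the combinations of
   their features; the states themselves are never added. *)
Let combination K w x := \sum_i z i * feature K w (st i) x.

Lemma combination_smooth K w : polyfun_on (vtx K) (combination K w).
Proof.
by apply: polyfun_on_sum => i; apply: polyfun_onZ; exact: smooth_feature.
Qed.

Lemma energy_combination j : \sum_i z i * energy (st i) (st j) =
  \sum_(K : elt Th) \sum_w weight K w * elt_int K (fun x => combination K w x * feature K w (st j) x).
Proof.
under eq_bigr do rewrite energyE// mulr_sumr.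
rewrite exchange_big; apply: eq_bigr => K _.
under eq_bigr do rewrite mulr_sumr.
rewrite exchange_big; apply: eq_bigr => w _ /=.
under [X in _ = _ * X]integral_rn_ext do rewrite mulr_suml.
rewrite (integral_rn_sum (nK K)).
  rewrite mulr_sumr; apply: eq_bigr => i _; rewrite mulrCA; congr (_ * _).
  rewrite -(integral_rnZ (nK K)); last by apply: polyfun_onM; exact: smooth_feature.
  by apply: integral_rn_ext => x _; rewrite mulrA.
by move=> i; apply: polyfun_onM; [apply: polyfun_onZ|]; exact: smooth_feature.
Qed.

Lemma energy_quadratic : \sum_j z j * (\sum_i z i * energy (st i) (st j)) =
  \sum_(K : elt Th) \sum_w weight K w * elt_int K (fun x => combination K w x ^+ 2).
Proof.
under eq_bigr do rewrite energy_combination mulr_sumr.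
rewrite exchange_big; apply: eq_bigr => K _.
under eq_bigr do rewrite mulr_sumr.
rewrite exchange_big; apply: eq_bigr => w _ /=.
under [X in _ = _ * X]integral_rn_ext do rewrite expr2 mulr_sumr.
rewrite (integral_rn_sum (nK K)).
  rewrite mulr_sumr; apply: eq_bigr => i _; rewrite mulrCA; congr (_ * _).
  rewrite -(integral_rnZ (nK K)); last first.
    by apply: polyfun_onM; [exact: combination_smooth|exact: smooth_feature].
  by apply: integral_rn_ext => x _; rewrite mulrCA.
by move=> i; apply: polyfun_onM; [exact: combination_smooth|apply: polyfun_onZ; exact: smooth_feature].
Qed.

Lemma energy_ge0 : 0 <= \sum_j z j * (\sum_i z i * energy (st i) (st j)).
Proof.
rewrite energy_quadratic; apply: sumr_ge0 => K _; apply: sumr_ge0 => w _.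
apply: mulr_ge0; first exact/ltW/weight_gt0.
by apply: integral_rn_ge0 => x _; exact: sqr_ge0.
Qed.

Lemma energy_eq0 : \sum_j z j * (\sum_i z i * energy (st i) (st j)) = 0 ->
  forall K w x, open_simplex (vtx K) x -> combination K w x = 0.
Proof.
have ge0 K w : 0 <= weight K w * elt_int K (fun x => combination K w x ^+ 2).
  apply: mulr_ge0; first exact/ltW/weight_gt0.
  by apply: integral_rn_ge0 => x _; exact: sqr_ge0.
rewrite energy_quadratic => /eqP; rewrite psumr_eq0; last first.
  by move=> K _; exact: sumr_ge0.
move=> /allP E0 K w x Kx; have := E0 K (mem_index_enum _).
rewrite psumr_eq0// => /allP/(_ w (mem_index_enum _)).
rewrite mulf_eq0 gt_eqF ?weight_gt0//= => /eqP I0.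
apply/eqP; rewrite -sqrf_eq0; apply/eqP.
apply: (integral_rn_eq0 (nK K) _ _ I0) => //.
- exact: (polyfun_onM (combination_smooth K w) (combination_smooth K w)).
- by move=> y _; exact: sqr_ge0.
Qed.

(** A state of zero energy is orthogonal to every state, since all its features
    vanish. *)
Lemma energy_kernel : \sum_j z j * (\sum_i z i * energy (st i) (st j)) = 0 ->
  forall j, \sum_i z i * energy (st i) (st j) = 0.
Proof.
move=> E0 j; rewrite energy_combination big1// => K _; rewrite big1// => w _.
rewrite (integral_rn_ext (g := fun=> 0)).
  by rewrite integral_rn0 ?mulr0.
by move=> x Kx; rewrite (energy_eq0 E0)// mul0r.
Qed.

End Gram.

End Forms.

(** * Local linear independence of the finite element bases *)

Section Basis.
Variables (R : realType) (d N : nat) (Th : mesh R d N).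

(** The unknowns of the interface problem are enumerated differently from the
    basis functions f; [lab] gives the basis function attached to an unknown, or
    [None] if it belongs to another space. Every basis function is active on some
    subdomain, where the local independence applies. *)
Lemma fe_basis_coef_eq0 n (f : 'I_n -> 'rV[R]_d -> R) (T : finType)
    (lab : T -> option 'I_n) (z : T -> R) :
  fe_basis Th (V := R^o) f ->
  (forall i i' j, lab i = Some j -> lab i' = Some j -> i = i') ->
  (forall (K : elt Th) x, open_simplex (vtx K) x ->
    \sum_i z i * (if lab i is Some j then f j x else 0) = 0) ->
  forall i j, lab i = Some j -> z i = 0.
Proof.
move=> [act free] lab_inj z0 i0 j0 labi0.
pose c j := \sum_(i | lab i == Some j) z i.
have cz : c j0 = z i0.
  rewrite /c (big_pred1 i0)// => i /=; apply/eqP/eqP => [labi|->//].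
  exact: lab_inj labi0.
have [D actD] := act j0; rewrite -cz; apply: free actD => K x _ Kx.
rewrite -[RHS](z0 K x Kx) /c.
under eq_bigr do rewrite scaler_suml big_mkcond.
rewrite exchange_big; apply: eq_bigr => i _ /=.
case: (lab i) => [j|]; last by rewrite mulr0 big1.
rewrite (bigD1 j)//= eqxx big1 ?addr0// => k /negbTE kj.
by case: eqP => // -[jk]; rewrite jk eqxx in kj.
Qed.

End Basis.

(** * The unknowns of the partially assembled problem *)

Section InterfaceMatrix.
Variables (R : realType) (d N : nat) (Th : mesh R d N)
  (GD GP : pred (elt Th * 'I_d.+1)) (co : coefficients R N) (fe : fe_data R d)
  (m : nat) (BD : 'M[R]_(m, #|idxVD Th fe|)).

Local Notation nA := #|idxA Th fe|.
Local Notation nW := #|idxWG Th fe|.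
Local Notation nQ := #|idxQG Th fe|.
Local Notation A := (A_tilde Th fe co).

(** The unknowns of A, followed by the interface pressures, in the order of the
    rows of the matrices. *)
Definition unknown : finType := ('I_nA + 'I_(nW + nQ))%type.

Definition basis (t : unknown) : state R d N :=
  match t with
  | inl a => basisA (enum_val a)
  | inr g => match fintype.split g with
             | inl r => ((fun=> fun=> 0), chiG r, (fun=> 0))
             | inr r => ((fun=> fun=> 0), (fun=> 0), phiG r)
             end
  end.

Definition labelW (t : unknown) : option 'I_(dimW fe) :=
  match t with
  | inl a => if enum_val a is inl (inl (inl (inr j))) then Some (val j) else None
  | inr g => if fintype.split g is inl r then Some (val (enum_val r)) else None
  end.

Definition labelQ (t : unknown) : option 'I_(dimQ fe) :=
  match t with
  | inl a => if enum_val a is inl (inl (inr j)) then Some (val j) else None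
  | inr g => if fintype.split g is inr r then Some (val (enum_val r)) else None
  end.

Definition is_displacement (t : unknown) : bool :=
  (labelW t == None) && (labelQ t == None).

Lemma basis_displacement t : is_displacement t -> displacement_state (basis t).
Proof.
rewrite /is_displacement /displacement_state; case: t => [a|g] /=.
  by case: (enum_val a) => [[[[j|j]|j]|j]|j].
by case: fintype.split.
Qed.

Lemma basis_pressure t : ~~ is_displacement t -> pressure_state (basis t).
Proof.
rewrite /is_displacement /pressure_state; case: t => [a|g] /=.
  by case: (enum_val a) => [[[[j|j]|j]|j]|j].
by case: fintype.split.
Qed.

Lemma basisW t x :
  (basis t).1.2 x = if labelW t is Some j then chi fe j x else 0.
Proof.
case: t => [a|g] /=; last by case: fintype.split.
by case: (enum_val a) => [[[[j|j]|j]|j]|j].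
Qed.

Lemma basisQ t x :
  (basis t).2 x = if labelQ t is Some j then phi fe j x else 0.
Proof.
case: t => [a|g] /=; last by case: fintype.split.
by case: (enum_val a) => [[[[j|j]|j]|j]|j].
Qed.

Lemma interior_not_interface (V : zmodType) (f : 'rV[R]_d -> V) :
  interior_dof Th f -> interface_dof Th f -> False.
Proof. by rewrite /interior_dof /interface_dof => /eqP ->. Qed.

(** A pressure unknown is interior or on the interface, but not both. *)
Lemma labelW_inj t t' j : labelW t = Some j -> labelW t' = Some j -> t = t'.
Proof.
have disjoint (i : idxWI Th fe) (r : idxWG Th fe) :
    val i = j -> val r = j -> False.
  move=> ij rj; apply: (@interior_not_interface _ (chi fe j : _ -> R^o)).
  - by rewrite -ij; exact: (valP i).
  - by rewrite -rj; exact: (valP r).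
case: t t' => [a|g] [a'|g'] /=.
- case Ea : (enum_val a) => [[[[k|i]|k]|k]|k] //= [ij].
  case Ea' : (enum_val a') => [[[[k|i']|k]|k]|k] //= [ij'].
  congr inl; apply: enum_val_inj; rewrite Ea Ea'.
  by have -> : i = i' by apply: val_inj; exact: (etrans ij (esym ij')).
- case Ea : (enum_val a) => [[[[k|i]|k]|k]|k] //= [ij].
  by case: fintype.split => // r [rj]; case: (disjoint _ _ ij rj).
- case Ea' : (enum_val a') => [[[[k|i]|k]|k]|k] //= + // => /[swap] -[ij].
  by case: fintype.split => // r [rj]; case: (disjoint _ _ ij rj).
- case: (split_ordP g) => r -> // [rj]; case: (split_ordP g') => r' -> // [rj'].
  have -> : r = r'; last by [].
  by apply/enum_val_inj/val_inj; exact: (etrans rj (esym rj')).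
Qed.

Lemma labelQ_inj t t' j : labelQ t = Some j -> labelQ t' = Some j -> t = t'.
Proof.
have disjoint (i : idxQI Th fe) (r : idxQG Th fe) :
    val i = j -> val r = j -> False.
  move=> ij rj; apply: (@interior_not_interface _ (phi fe j : _ -> R^o)).
  - by rewrite -ij; exact: (valP i).
  - by rewrite -rj; exact: (valP r).
case: t t' => [a|g] [a'|g'] /=.
- case Ea : (enum_val a) => [[[k|i]|k]|k] //= [ij].
  case Ea' : (enum_val a') => [[[k|i']|k]|k] //= [ij'].
  congr inl; apply: enum_val_inj; rewrite Ea Ea'.
  by have -> : i = i' by apply: val_inj; exact: (etrans ij (esym ij')).
- case Ea : (enum_val a) => [[[k|i]|k]|k] //= [ij].
  by case: fintype.split => // r [rj]; case: (disjoint _ _ ij rj).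
- case Ea' : (enum_val a') => [[[k|i]|k]|k] //= + // => /[swap] -[ij].
  by case: fintype.split => // r [rj]; case: (disjoint _ _ ij rj).
- case: (split_ordP g) => r -> // [rj]; case: (split_ordP g') => r' -> // [rj'].
  have -> : r = r'; last by [].
  by apply/enum_val_inj/val_inj; exact: (etrans rj (esym rj')).
Qed.

Hypothesis nK : forall K : elt Th, Defs.nondegenerate (vtx K).
Hypothesis co_gt0 : positive_coefficients co.
Hypothesis fe_ok : fe_spaces fe GD GP.

Local Notation K s t := (form_K Th co (basis s) (basis t)).
Local Notation E s t := (energy Th co (basis s) (basis t)).

Lemma basis_smooth t : smooth_state Th (basis t).
Proof.
have [[_ [psiH _]] [_ chiL] [_ [phiH _]]] := fe_ok.
have sub (f : 'rV[R]_d -> R) (L : elt Th) :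
    polynomial_on (simplex (vtx L)) f -> polyfun_on (vtx L) f.
  move=> [p fp]; apply: polynomial_on_polyfun_on; exists p => x Lx.
  by apply: fp; exact: open_simplex_sub.
move=> L; split=> [i l||].
- have z0 : polyfun_on (vtx L) (fun=> (0 : 'rV[R]_d) 0 l).
    exact: (polyfun_on_cst _ ((0 : 'rV[R]_d) 0 l)).
  have psiL j : polyfun_on (vtx L) (fun y => psi fe j y 0 l) by exact/sub/psiH.
  case: t => [a|g] /=; last by case: fintype.split.
  case: (enum_val a) => [[[[j|j]|j]|j]|j] //=.
  by case: (i == _).
- rewrite (_ : _.1.2 = fun x => if labelW t is Some j then chi fe j x else 0).
    by case: labelW => [j|]; [exact/polynomial_on_polyfun_on/chiL|exact: polyfun_on_cst].
  by apply/funext => x; exact: basisW.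
- rewrite (_ : _.2 = fun x => if labelQ t is Some j then phi fe j x else 0).
    by case: labelQ => [j|]; [exact/sub/phiH|exact: polyfun_on_cst].
  by apply/funext => x; exact: basisQ.
Qed.

(** * The saddle-point identity *)

Definition saddle_sign (t : unknown) : R := if is_displacement t then 1 else -1.

(** With the signs, K is the sum of E and of a form that is skew-symmetric: it
    couples displacements and pressures only, and K is symmetric. *)
Lemma saddle_energy (z : unknown -> R) :
  \sum_s saddle_sign s * z s * (\sum_t z t * K t s) =
  \sum_s z s * (\sum_t z t * E t s).
Proof.
pose skew t s := saddle_sign s * K t s - E t s.
have skewN t s : skew t s = - skew s t.
  rewrite /skew /saddle_sign [K s t]form_K_sym [E s t]energy_sym.
  have [dt|/negPf dt] := boolP (is_displacement t);
    have [ds|/negPf ds] := boolP (is_displacement s).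
  - by rewrite form_K_dd; [ring| |]; exact: basis_displacement.
  - rewrite energy_dp; [by ring|exact: basis_displacement|].
    by apply: basis_pressure; rewrite ds.
  - rewrite energy_sym energy_dp; [by ring|exact: basis_displacement|].
    by apply: basis_pressure; rewrite dt.
  - by rewrite form_K_pp; [ring| |]; apply: basis_pressure; rewrite ?ds ?dt.
have S0 : \sum_s \sum_t z s * z t * skew t s = 0.
  have : \sum_s \sum_t z s * z t * skew t s = - \sum_s \sum_t z s * z t * skew t s.
    rewrite [LHS]exchange_big -sumrN; apply: eq_bigr => s _.
    by rewrite -sumrN; apply: eq_bigr => t _; rewrite skewN; ring.
  by move/eqP; rewrite -addr_eq0 -mulr2n mulrn_eq0/= => /eqP.
rewrite -[RHS]addr0 -[X in _ = _ + X]S0 -big_split; apply: eq_bigr => s _ /=.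
rewrite !mulr_sumr -big_split; apply: eq_bigr => t _ /=.
by rewrite /skew; ring.
Qed.

(** C1 and B1 couple the interface pressures with themselves and with the unknowns
   of A; J extends the jump matrix by zero to all the unknowns of A. *)
Let C1 : 'M[R]_(nW + nQ) :=
  block_mx (- C_GG Th fe co) (D_GG Th fe co)^T (D_GG Th fe co) (- E_GG Th fe co).
Let B1 : 'M[R]_(nW + nQ, nA) := usubmx (BC_tilde co BD).
Let J : 'M[R]_(m, nA) := dsubmx (BC_tilde co BD).

Lemma A_tildeE a a' : A a a' = K (inl a') (inl a).
Proof. by rewrite mxE. Qed.

Lemma B1E g a : B1 g a = K (inl a) (inr g).
Proof.
rewrite /B1 /BC_tilde col_mxKu /=.
by case: split_ordP => r ->; rewrite (col_mxEu, col_mxEd) mxE.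
Qed.

Lemma C1E g g' : C1 g g' = K (inr g') (inr g).
Proof.
rewrite /C1 /=; case: (split_ordP g) => r ->; case: (split_ordP g') => r' ->.
- rewrite block_mxEul !mxE /form_K.
  by rewrite form_a0 !form_b0l !form_d0l form_e0; ring.
- rewrite block_mxEur !mxE /form_K.
  by rewrite form_a0 !form_b0l form_c0 form_d0l form_e_sym form_e0; ring.
- rewrite block_mxEdl !mxE /form_K.
  by rewrite form_a0 !form_b0l form_c_sym form_c0 form_d0l form_e0; ring.
- rewrite block_mxEdr !mxE /form_K.
  by rewrite form_a0 !form_b0l form_c0 !form_d0r; ring.
Qed.

Lemma BC_tildeE : BC_tilde co BD = col_mx B1 J.
Proof. by rewrite vsubmxK. Qed.

Lemma C_tildeE : C_tilde Th fe co m = block_mx C1 0 0 0.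
Proof. by []. Qed.

Lemma J_dual l a : J l a =
  if enum_val a is inl (inr ij) then BD l (enum_rank ij) else 0.
Proof. by rewrite /J /BC_tilde col_mxKd mxE. Qed.

Lemma J_pressure l a : ~~ is_displacement (inl a) -> J l a = 0.
Proof.
rewrite J_dual /is_displacement /=.
by case: (enum_val a) => [[[[j|j]|j]|j]|j].
Qed.

(** The jumps involve displacements only, whose sign is not reversed. *)
Lemma saddle_sign_J l a : saddle_sign (inl a) * J l a = J l a.
Proof.
rewrite /saddle_sign; case: ifPn => [_|/J_pressure ->]; first exact: mul1r.
by rewrite mulr0.
Qed.

Lemma A_tilde_sym : A^T = A.
Proof. by apply/matrixP => a a'; rewrite mxE !A_tildeE form_K_sym. Qed.

Lemma C1_sym : C1^T = C1.
Proof. by apply/matrixP => g g'; rewrite mxE !C1E form_K_sym. Qed.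

Lemma interface_matrix_sym : (interface_matrix co BD)^T = interface_matrix co BD.
Proof.
rewrite /interface_matrix linearB/= !trmx_mul trmxK trmx_inv A_tilde_sym mulmxA.
by rewrite C_tildeE tr_block_mx C1_sym !trmx0.
Qed.

Hypothesis A_unit : A \in unitmx.

Local Arguments basis : simpl never.

(** * Positivity of the interface form *)

Section Quadratic.
Variables (x1 : 'cV[R]_(nW + nQ)) (l : 'cV[R]_m).

Let y : 'cV[R]_nA := - (invmx A *m (BC_tilde co BD)^T *m col_mx x1 l).

Definition lift_unknown (t : unknown) : R :=
  match t with inl a => y a 0 | inr g => x1 g 0 end.

(** The rows of the equation A y + B1^T x1 + J^T l = 0, which defines y. *)
Lemma interior_equation a :
  \sum_t lift_unknown t * K t (inl a) = - (J^T *m l) a 0.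
Proof.
have : A *m y + B1^T *m x1 = - (J^T *m l).
  rewrite /y mulmxN -!mulmxA mulKVmx// BC_tildeE tr_col_mx mul_row_col.
  by rewrite opprD addrAC addNr add0r.
move=> /matrixP/(_ a 0); rewrite [RHS]mxE => <-.
rewrite big_sumType/= [RHS]mxE [in RHS]mxE [X in _ = _ + X]mxE.
congr (_ + _); apply: eq_bigr => i _.
  by rewrite A_tildeE mulrC.
by rewrite [B1^T _ _]mxE B1E [K (inr _) _]form_K_sym mulrC.
Qed.

Lemma interface_equation g :
  \sum_t lift_unknown t * K t (inr g) = (B1 *m y + C1 *m x1) g 0.
Proof.
rewrite big_sumType/= mxE [in RHS]mxE [X in _ = _ + X]mxE.
by congr (_ + _); apply: eq_bigr => i _; rewrite (B1E, C1E) mulrC.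
Qed.

(** x^T G x = - x1^T (B1 y + C1 x1) - y^T J^T l, and the two terms are the sums
    over the interface pressures and over the unknowns of A in the left-hand side
    of [saddle_energy]. *)
Lemma interface_quadratic :
  ((col_mx x1 l)^T *m interface_matrix co BD *m col_mx x1 l) 0 0 =
  \sum_s lift_unknown s * (\sum_t lift_unknown t * E t s).
Proof.
rewrite -saddle_energy big_sumType/=.
under eq_bigr do rewrite interior_equation.
under [X in _ = _ + X]eq_bigr do rewrite interface_equation.
have -> : (col_mx x1 l)^T *m interface_matrix co BD *m col_mx x1 l =
    - (y^T *m (J^T *m l))^T - x1^T *m (B1 *m y + C1 *m x1).
  rewrite /interface_matrix mulmxBr mulmxBl.
  have -> : (col_mx x1 l)^T *m (BC_tilde co BD *m invmx A *m (BC_tilde co BD)^T) *m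
     col_mx x1 l = - ((col_mx x1 l)^T *m (BC_tilde co BD *m y)).
    by rewrite /y !mulmxN opprK !mulmxA.
  rewrite BC_tildeE C_tildeE tr_col_mx mul_col_mx mul_row_col mul_row_block.
  rewrite !mulmx0 !addr0 mul_row_col mul0mx addr0.
  rewrite mulmxDr !trmx_mul !trmxK opprD opprD mulmxA -mulmxA.
  by rewrite addrA; congr (_ - _); rewrite ?mulmxA// addrC.
rewrite mxE; congr (_ + _).
  rewrite 3!mxE -sumrN; apply: eq_bigr => a _.
  rewrite mulrN mxE; congr (- _).
  rewrite [saddle_sign _ * _]mulrC -mulrA; congr (_ * _).
  rewrite mxE mulr_sumr; apply: eq_bigr => i _.
  by rewrite mulrA [J^T _ _]mxE saddle_sign_J.
rewrite mxE [in LHS]mxE -sumrN; apply: eq_bigr => g _.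
rewrite /saddle_sign (_ : is_displacement _ = false).
  by rewrite mulN1r mulNr mxE.
by rewrite /is_displacement /=; case: fintype.split.
Qed.

Lemma interface_quadratic_gt0 : in_Lambda BD l -> col_mx x1 l != 0 ->
  0 < ((col_mx x1 l)^T *m interface_matrix co BD *m col_mx x1 l) 0 0.
Proof.
move=> [w lw] x_neq0; rewrite interface_quadratic lt_neqAle eq_sym.
rewrite (energy_ge0 nK co_gt0 _ basis_smooth) andbT.
apply: contra_neq x_neq0 => E0.
have zero := energy_eq0 nK co_gt0 basis_smooth E0.
have [_ [chiB _] [phiB _]] := fe_ok.
(* The feature [inr false] is p; it is treated first since it enters the feature
   [inr true], which is xi - alpha p. *)
have zQ : forall t j, labelQ t = Some j -> lift_unknown t = 0.
  apply: (fe_basis_coef_eq0 phiB labelQ_inj) => L x Lx.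
  rewrite -[RHS](zero L (inr false) x Lx); apply: eq_bigr => t _.
  by rewrite /feature basisQ.
have zW : forall t j, labelW t = Some j -> lift_unknown t = 0.
  apply: (fe_basis_coef_eq0 chiB labelW_inj) => L x Lx.
  rewrite -[RHS](zero L (inr true) x Lx); apply: eq_bigr => t _.
  rewrite /feature basisW basisQ; case Qt : (labelQ t) => [j|].
    by rewrite (zQ _ _ Qt) !mul0r.
  by rewrite mulr0 addr0.
have x10 : x1 = 0.
  apply/matrixP => g o; rewrite ord1 mxE; have [r gr|r gr] := split_ordP g.
  - apply: (zW (inr g) (val (enum_val r))).
    by rewrite /= gr (unsplitK (inl r)).
  - apply: (zQ (inr g) (val (enum_val r))).
    by rewrite /= gr (unsplitK (inr r)).
have Ez := energy_kernel nK co_gt0 basis_smooth E0.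
(* The pressures being zero, K(z, v) = E(z, v) = 0 for every displacement v. *)
have lJ : J^T *m l = 0.
  apply/matrixP => a o; rewrite ord1 [RHS]mxE.
  have [da|da] := boolP (is_displacement (inl a)); last first.
    by rewrite mxE big1// => i _; rewrite mxE J_pressure ?mul0r.
  apply/eqP; rewrite -oppr_eq0 -interior_equation -[X in _ == X](Ez (inl a)).
  apply/eqP/eq_bigr => t _.
  have [dt|] := boolP (is_displacement t).
    by rewrite form_K_dd//; exact: basis_displacement.
  rewrite /is_displacement; case Wt : (labelW t) => [j|].
    by rewrite (zW _ _ Wt) !mul0r.
  by case Qt : (labelQ t) => [j|//]; rewrite (zQ _ _ Qt) !mul0r.
suff -> : l = 0 by rewrite x10 col_mx0.
have BDl : BD^T *m l = 0.
  apply/matrixP => r o; rewrite ord1 [RHS]mxE.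
  have := congr1 (fun M : 'cV_nA => M (enum_rank (inl (inr (enum_val r)) : idxA Th fe)) 0) lJ.
  rewrite [X in _ = X -> _]mxE => <-.
  rewrite [LHS]mxE [RHS]mxE; apply: eq_bigr => i _.
  by rewrite [BD^T _ _]mxE [J^T _ _]mxE J_dual enum_rankK enum_valK.
have : (l^T *m l) 0 0 = 0.
  by rewrite {1}lw trmx_mul -mulmxA BDl mulmx0 mxE.
rewrite mxE => /eqP; rewrite psumr_eq0; last first.
  by move=> i _; rewrite mxE -expr2 sqr_ge0.
move=> /allP l0; apply/matrixP => i o; rewrite ord1 [RHS]mxE.
by have := l0 i (mem_index_enum _); rewrite mxE mulf_eq0 orbb => /eqP.
Qed.

End Quadratic.
End InterfaceMatrix.

Unset Implicit Arguments.

(** * The interface matrix is symmetric positive definite *)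

Theorem mainTheorem1 (R : realType) (d N : nat) (Th : mesh R d N)
    (sigma tau : R) (GD GP : pred (elt Th * 'I_d.+1))
    (co : coefficients R N) (fe : fe_data R d) (betaS : R)
    (m : nat) (BD : 'M[R]_(m, #|idxVD Th fe|)) :
  d = 2%N \/ d = 3%N ->
  conforming_triangulation Th -> shape_regular Th sigma ->
  quasi_uniform Th tau -> coarse_partition Th ->
  0 < boundary_part_measure GD -> 0 < boundary_part_measure GP ->
  positive_coefficients co ->
  fe_spaces fe GD GP -> stokes_stable Th fe betaS ->
  primal_space fe GD -> controls_rigid_motions fe GD ->
  jump_matrix BD ->
  A_tilde Th fe co \in unitmx ->
  (interface_matrix co BD)^T = interface_matrix co BD /\
  (forall (xi : 'cV[R]_#|idxWG Th fe|) (p : 'cV[R]_#|idxQG Th fe|)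
          (l : 'cV[R]_m),
     in_Lambda BD l ->
     let x := col_mx (col_mx xi p) l in
     x != 0 -> 0 < (x^T *m interface_matrix co BD *m x) 0 0).

Proof.
move=> _ [nK _ _ _] _ _ _ _ _ co_gt0 fe_ok _ _ _ _ A_unit; split.
  exact: interface_matrix_sym.
by move=> xi p l lL x x_neq0; exact: (interface_quadratic_gt0 nK co_gt0 fe_ok).
Qed.
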